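(* The number $9$ is the only composite number in the base sequence. That is, let $S$ be the set of positive integers $n$ such that no odd Fibonacci number is divisible by $n$, and let $B$ be the set of those $n \in S$ that are not a multiple of any element of $S$ other than $n$ itself. Then $9 \in B$, and every composite number belonging to $B$ is equal to $9$.
   Context: The Fibonacci numbers are $F_0 = 0$, $F_1 = 1$, $F_{n+2} = F_{n+1} + F_n$. The base sequence is the set $B$ obtained from the set $S$ of all positive integers $n$ that divide no odd Fibonacci number by removing every element of $S$ that is a multiple of another element of $S$. A composite number is an integer greater than $1$ that is not prime. *)

(* Defs.v *)
From mathcomp Require Import all_boot.

Set Implicit Arguments.
Unset Strict Implicit.
Unset Printing Implicit Defensive.

Fixpoint fib (n : nat) : nat :=
  match n with
  | 0 => 0
  | p.+1 => match p with
            | 0 => 1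
            | q.+1 => fib p + fib q
            end
  end.

Definition divides_no_odd_fib (n : nat) : Prop :=
  0 < n /\ forall k : nat, odd (fib k) -> ~~ (n %| fib k).

Definition in_base_sequence (n : nat) : Prop :=
  divides_no_odd_fib n /\
  forall m : nat, divides_no_odd_fib m -> m %| n -> m = n.

Definition composite (n : nat) : bool := (1 < n) && ~~ prime n.

(* Main.v *)
(** Since fib k is odd exactly when 3 does not divide k, n belongs to S iff
    every index k with n | fib k is a multiple of 3.  If coprime a and b divide
    fib k and fib l with k, l prime to 3, then a * b divides fib (k * l); and if
    a prime p <> 3 divides fib k, then p^e divides fib (k * p^(e-1)).  So an
    element of S with a prime divisor p has p or its p'-part in S, unless p = 3
    and 9 divides it, and 9 itself is in S. *)
Require Import Defs.
From mathcomp Require Import all_boot.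
From mathcomp Require Import ring.

Lemma fibSS n : fib n.+2 = fib n.+1 + fib n. Proof. by []. Qed.

Lemma fib_addS m n : fib (m + n.+1) = fib m.+1 * fib n.+1 + fib m * fib n.
Proof.
elim: n m => [|n IHn] m; first by rewrite addn1 muln1 muln0 addn0.
by rewrite addnS -addSn IHn !fibSS; ring.
Qed.

Lemma coprime_fibS n : coprime (fib n) (fib n.+1).
Proof. by elim: n => // n IHn; rewrite fibSS /coprime gcdnDl gcdnC. Qed.

(** By the addition formula, shifting an index by [n] multiplies [fib] modulo [d] by the previous
    Fibonacci number, which is coprime to [d]. *)
Lemma dvdn_fib_modn d n k :
  d %| fib n -> (d %| fib k) = (d %| fib (k %% n)).
Proof.
case: n => [|n] dFn; first by rewrite modn0.
have coF : coprime d (fib n).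
  by apply: coprime_dvdl dFn _; rewrite coprime_sym coprime_fibS.
rewrite [in LHS](divn_eq k n.+1) addnC.
elim: (k %/ n.+1) => [|q IHq]; first by rewrite addn0.
rewrite mulSn addnCA addnC fib_addS dvdn_addr; last exact: dvdn_mull.
by rewrite Gauss_dvdl.
Qed.

Lemma dvdn_fib d k j : d %| fib k -> d %| fib (k * j).
Proof. by move=> dFk; rewrite (dvdn_fib_modn _ k) // modnMr. Qed.

Lemma odd_fib k : odd (fib k) = ~~ (3 %| k).
Proof.
rewrite -[LHS]negbK -dvdn2 (dvdn_fib_modn 2 3) // /dvdn.
by case: (k %% 3) (ltn_pmod k (isT : 0 < 3)) => [|[|[|]]].
Qed.

(* The second equation says [g * fib k = j * fib (k.+1 * j).+1] modulo
   [fib k.+1]; subtraction-free, it passes from [j] to [j.+1] by the addition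
   formula. *)
Lemma fib_mulS k j : exists g c : nat,
  fib (k.+1 * j) = fib k.+1 * g /\
  j * fib (k.+1 * j).+1 = g * fib k + fib k.+1 * c.
Proof.
elim: j => [|j [g [c [Eg Ec]]]]; first by exists 0, 0; rewrite !muln0.
set h := fib (k.+1 * j).+1 in Ec.
exists (h + g * fib k), (c * fib k + j.+1 * (h + g * fib k.+1)).
rewrite mulnS addnC -addnS !fib_addS fibSS -/h Eg; split; first by ring.
transitivity (h * fib k + j * h * fib k
  + fib k.+1 * (j.+1 * (h + g * fib k.+1))); first by ring.
by rewrite Ec; ring.
Qed.

(** With the positive index written [k.+1], [d] divides [g * fib k] in [fib_mulS]; as [fib k] is
    coprime to [d], the cofactor [g] supplies the extra factor [d]. *)
Lemma dvdn_fib_lift d q k j :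
  d %| j -> d %| fib k -> q %| fib k -> q * d %| fib (k * j).
Proof.
case: k => [|k] dj dF qF; first by rewrite mul0n dvdn0.
have [g [c [-> Ec]]] := fib_mulS k j.
apply: dvdn_mul => //.
have coF : coprime d (fib k).
  by apply: coprime_dvdl dF _; rewrite coprime_sym coprime_fibS.
by rewrite -(Gauss_dvdl _ coF) -(dvdn_addl _ (dvdn_mulr c dF)) -Ec dvdn_mulr.
Qed.

Lemma dvdn_fib_expn p e k : p %| fib k -> p ^ e.+1 %| fib (k * p ^ e).
Proof.
move=> pF; elim: e => [|e IHe]; first by rewrite muln1.
by rewrite expnSr [X in fib (k * X)]expnSr mulnA dvdn_fib_lift // dvdn_fib.
Qed.

Lemma divides_no_odd_fib_coprime_mul a b :
  0 < a -> 0 < b -> coprime a b ->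
  ~ divides_no_odd_fib a -> ~ divides_no_odd_fib b ->
  ~ divides_no_odd_fib (a * b).
Proof.
move=> a_gt0 b_gt0 co_ab Sa Sb [_ Sab].
(* The goal is [False], so each negated membership can be applied to obtain its index [k] or [l]
   constructively. *)
apply: Sa; split=> // k odd_k; apply/negP=> aFk.
apply: Sb; split=> // l odd_l; apply/negP=> bFl.
have /Sab/negP[] : odd (fib (k * l)).
  by move: odd_k odd_l; rewrite !odd_fib Euclid_dvdM // negb_or => -> ->.
by rewrite Gauss_dvd // dvdn_fib //= mulnC dvdn_fib.
Qed.

Lemma divides_no_odd_fib_expn p e :
  prime p -> p != 3 ->
  ~ divides_no_odd_fib p -> ~ divides_no_odd_fib (p ^ e.+1).
Proof.
move=> p_pr p_neq3 Sp [_ Spe]; apply: Sp; split=> [|k odd_k].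
  exact: prime_gt0.
apply/negP=> pFk.
have /Spe/negP[] : odd (fib (k * p ^ e)); last exact: dvdn_fib_expn.
(* Since [p != 3], the factor [p ^ e] keeps the index prime to 3. *)
rewrite odd_fib Euclid_dvdM // negb_or -odd_fib odd_k /=.
by rewrite Euclid_dvdX // dvdn_prime2 // eq_sym (negPf p_neq3).
Qed.

Lemma divides_no_odd_fib_9 : divides_no_odd_fib 9.
Proof.
(* [fib 12 = 144] is a multiple of 9 and 3 divides 12, so only the residues modulo 12 need
   checking. *)
split=> // k; rewrite odd_fib (dvdn_fib_modn 9 12) //.
rewrite {1}/dvdn -(@modn_dvdm 12 k 3) //.
by move: (k %% 12) (ltn_pmod k (isT : 0 < 12)); do 12![case=> //].
Qed.

Lemma not_divides_no_odd_fib_3 : ~ divides_no_odd_fib 3.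
Proof. by case=> _ /(_ 4 isT). Qed.

Theorem theorem5p1 :
  in_base_sequence 9 /\
  (forall n : nat, composite n -> in_base_sequence n -> n = 9).
Proof.
split.
  split=> [|m Sm m9]; first exact: divides_no_odd_fib_9.
  have /(dvdn_pfactor m 2 (isT : prime 3))[[|[|[|]]] // _ Em] := m9.
    by case: Sm => _ /(_ 1 isT); rewrite Em.
  by case: not_divides_no_odd_fib_3; rewrite Em in Sm.
move=> n /andP[n_gt1 n_npr] [Sn minSn].
have n_gt0 : 0 < n by exact: ltnW.
have p_pr := pdiv_prime n_gt1; have pn := pdiv_dvd n.
move: (pdiv n) p_pr pn => p p_pr pn.
have Sp : ~ divides_no_odd_fib p.
  by move=> /minSn/(_ pn) En; rewrite En in p_pr; rewrite p_pr in n_npr.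
have [m co_pm En] := pfactor_coprime p_pr n_gt0.
have: 0 < logn p n by rewrite logn_gt0 mem_primes p_pr n_gt0.
case: (logn p n) En => // e En _.
have m_gt0 : 0 < m by move: n_gt0; rewrite En muln_gt0 => /andP[].
have pe_gt0 : 0 < p ^ e.+1 by rewrite expn_gt0 prime_gt0.
have Sm : ~ divides_no_odd_fib m.
  (* By minimality [m] would equal [n], which [p] divides. *)
  move=> /minSn Emn; move: co_pm; rewrite prime_coprime // Emn ?pn //.
  by rewrite [X in _ %| X]En dvdn_mulr.
have [p3 | p_neq3] := eqVneq p 3; last first.
  have Spe := divides_no_odd_fib_expn p e p_pr p_neq3 Sp.
  case: (divides_no_odd_fib_coprime_mul m (p ^ e.+1)) => //.
    by rewrite coprime_sym coprimeXl.
  by rewrite -En.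
(* For [p = 3], exponent 1 leaves the coprime product [m * 3]; a larger exponent makes 9 divide
   [n]. *)
case: e En pe_gt0 => [|e] En _.
  case: (divides_no_odd_fib_coprime_mul m p) => //; first exact: prime_gt0.
    by rewrite coprime_sym.
  by rewrite -[p]expn1 -En.
apply/esym/minSn; first exact: divides_no_odd_fib_9.
by rewrite En p3 dvdn_mull // (dvdn_exp2l 3 (isT : 2 <= e.+2)).
Qed.
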